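(* Consider Hopf bifurcation from a stable equilibrium in the 3-node fully inhomogeneous unidirectional ring, with time scaled so that the critical eigenvalues are $\pm\mathrm{i}$. That is, let $a_1,a_2,a_3,b_1,b_2,b_3\in\mathbb{R}$ be such that $$J=\begin{bmatrix} a_1 & b_1 & 0 \\ 0 & a_2 & b_2 \\ b_3 & 0 & a_3 \end{bmatrix}$$ has eigenvalues $\mathrm{i}$, $-\mathrm{i}$ and a real eigenvalue $\tau<0$. Then the periodic solution is a rotating wave if and only if all of $a_1,a_2,a_3,b_1,b_2,b_3$ are negative.
   Context: $J$ is the Jacobian, at the bifurcation point, of an ODE $\dot x_1=f_1(x_1,x_2)$, $\dot x_2=f_2(x_2,x_3)$, $\dot x_3=f_3(x_3,x_1)$ with $x_j\in\mathbb{R}$. Under the stated hypothesis all $b_j$ are nonzero. The phase shifts between successive nodes are those of the linearised eigenfunction $e^{\mathrm{i}t}u$ (with $u$ an eigenvector of $J$ for the eigenvalue $\mathrm{i}$), namely $\theta_j=2\pi-\arg\left(\frac{\mathrm{i}-a_j}{b_j}\right)$ mod $2\pi$, $j=1,2,3$, where $\arg$ takes values in $[0,2\pi)$. The first, second, third and fourth (open) quadrants consist of angles in $(0,\pi/2)$, $(\pi/2,\pi)$, $(\pi,3\pi/2)$, $(3\pi/2,2\pi)$ respectively. The periodic solution is called a rotating wave if all three $\theta_j$ lie in quadrant 2, or all three $\theta_j$ lie in quadrant 3. *)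

(* Defs.v *)
From HB Require Import structures.
From mathcomp Require Import all_boot all_order all_algebra.
From mathcomp Require Import reals trigo complex.

Set Implicit Arguments.
Unset Strict Implicit.
Unset Printing Implicit Defensive.

Import Order.TTheory GRing.Theory Num.Theory.

Local Open Scope ring_scope.
Local Open Scope complex_scope.

(* Nodes are 0, 1, 2 : 'I_3 and [j + 1] is addition modulo 3, so the nonzero
   off-diagonal entries are b 0 at (0, 1), b 1 at (1, 2) and b 2 at (2, 0). *)
Definition ring_jacobian (R : realType) (a b : 'I_3 -> R) : 'M[R]_3 :=
  \matrix_(i, j) (if j == i then a i else if j == i + 1 then b i else 0).

Definition jacobianC (R : realType) (a b : 'I_3 -> R) : 'M[R[i]]_3 :=
  map_mx (real_complex R) (ring_jacobian a b).

(* The argument in [0, 2 pi); the value at 0 is irrelevant. See [argP]. *)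
Definition arg (R : realType) (z : R[i]) : R :=
  let t := acos (complex.Re z / Normc.normc z) in
  if 0 <= complex.Im z then t else 2 * pi - t.

Definition mod2pi (R : realType) (x : R) : R :=
  x - (Num.floor (x / (2 * pi)))%:~R * (2 * pi).

Definition phase_shift (R : realType) (a b : 'I_3 -> R) (j : 'I_3) : R :=
  mod2pi (2 * pi - arg (('i%C - (a j)%:C) / (b j)%:C)).

Definition quadrant2 (R : realType) (x : R) : bool := pi / 2 < x < pi.
Definition quadrant3 (R : realType) (x : R) : bool := pi < x < 3 * pi / 2.

Definition rotating_wave (R : realType) (a b : 'I_3 -> R) : Prop :=
  (forall j, quadrant2 (phase_shift a b j)) \/
  (forall j, quadrant3 (phase_shift a b j)).

Lemma argP (R : realType) (z : R[i]) : z != 0 ->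
  0 <= arg z < 2 * pi /\
  z = (Normc.normc z)%:C * (cos (arg z) +i* sin (arg z)).
Proof.
case: z => x y; rewrite eq_complex /= => z0.
have xy0 : 0 < x ^+ 2 + y ^+ 2.
  rewrite lt_neqAle addr_ge0 ?sqr_ge0// andbT eq_sym paddr_eq0 ?sqr_ge0//.
  by rewrite !sqrf_eq0.
rewrite /arg /=; set n := Num.sqrt _.
have n0 : 0 < n by rewrite sqrtr_gt0.
have nn : n ^+ 2 = x ^+ 2 + y ^+ 2 by rewrite sqr_sqrtr// ltW.
have xn : -1 <= x / n <= 1.
  rewrite -ler_norml normrM normfV (gtr0_norm n0) ler_pdivrMr// mul1r.
  by rewrite -sqrtr_sqr ler_wsqrtr// lerDl sqr_ge0.
have sE : n * sin (acos (x / n)) = `|y|.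
  rewrite sin_acos// -{1}(gtr0_norm n0) -sqrtr_sqr -sqrtrM ?sqr_ge0//.
  rewrite mulrBr mulr1 exprMn exprVn mulrCA divff ?sqrf_eq0 ?gt_eqF// mulr1.
  by rewrite nn addrC addKr sqrtr_sqr.
have cE : n * cos (acos (x / n)) = x.
  by rewrite acosK ?in_itv//= mulrC divfK// gt_eqF.
have [t0 tpi] := (acos_ge0 xn, acos_lepi xn).
have p0 : (0 : R) < pi by exact: pi_gt0.
have [y0|y0] := leP 0 y.
  split; first by rewrite t0 (le_lt_trans tpi)// mulr_natl mulr2n ltrDl.
  by apply/eqP; rewrite eq_complex /= !mul0r subr0 addr0 cE sE ger0_norm// !eqxx.
rewrite mulr_natl; split.
  rewrite subr_ge0 (le_trans tpi) ?mulr2n ?lerDl 1?ltW//=.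
  rewrite ltrBlDr ltrDl lt_neqAle t0 andbT eq_sym; apply/eqP => t00.
  by move: sE; rewrite t00 sin0 mulr0 => /esym/eqP; rewrite normr_eq0 lt_eqF.
rewrite (addrC (pi *+ 2)) cosD2pi sinD2pi cosN sinN.
apply/eqP; rewrite eq_complex /= !mul0r subr0 addr0 mulrN cE sE.
by rewrite ltr0_norm// opprK !eqxx.
Qed.

Lemma cos_sin_mod2pi (R : realType) (x : R) :
  cos (mod2pi x) = cos x /\ sin (mod2pi x) = sin x.
Proof.
rewrite /mod2pi; move: (Num.floor _) => m; rewrite mulrzl mulr_natl.
have [C S] := (periodicn (@cosD2pi R), periodicn (@sinD2pi R)).
case: m => n; last by rewrite NegzE mulrNz opprK C S.
by split; [rewrite -(C n) subrK | rewrite -(S n) subrK].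
Qed.

(* In the linearised eigenfunction e^(it) u, node j + 1 is, up to a positive
   amplitude, node j delayed by the phase [phase_shift a b j]. *)
Lemma phase_shiftP (R : realType) (a b : 'I_3 -> R) (u : 'cV[R[i]]_3)
    (j : 'I_3) : jacobianC a b *m u = 'i%C *: u -> b j != 0 ->
  exists2 r : R, 0 < r &
    u (j + 1) 0 =
    r%:C * (cos (phase_shift a b j) -i* sin (phase_shift a b j)) * u j 0.
Proof.
move=> /matrixP /(_ j 0); rewrite !mxE => uE bj0.
have jj : (j == j + 1) = false by case: j {uE bj0} => -[|[|[|]]].
have bC0 : (b j)%:C != 0 :> R[i] by rewrite eq_complex /= eqxx andbT.
set w := ('i%C - (a j)%:C) / (b j)%:C.
have w0 : w != 0.
  rewrite mulf_neq0 ?invr_eq0// eq_complex /= negb_and.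
  by rewrite oppr0 addr0 oner_eq0 orbT.
have uw : u (j + 1) 0 = w * u j 0.
  have {}uE : (a j)%:C * u j 0 + (b j)%:C * u (j + 1) 0 = 'i%C * u j 0.
    rewrite -uE (bigD1 j)//= (bigD1 (j + 1)) ?(eq_sym _ j) ?jj//= big1 => [|k].
      by rewrite !mxE !eqxx (eq_sym _ j) jj addr0.
    case/andP => /negPf kj /negPf kj1.
    by rewrite !mxE kj kj1 mul0r.
  apply: (mulfI bC0); rewrite mulrA (mulrC (b j)%:C w) divfK// mulrBl -uE.
  by rewrite [RHS]addrC addKr.
have [_ wE] := argP w0.
exists (Normc.normc w).
  have n0 : Normc.normc w != 0 by apply: contra w0 => /eqP/Normc.eq0_normc ->.
  by rewrite lt_neqAle eq_sym n0; case: (w) => x y; rewrite sqrtr_ge0.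
rewrite uw [in LHS]wE; congr (_ * _ * _).
have [cE sE] := cos_sin_mod2pi (2 * pi - arg w).
rewrite /phase_shift -/w cE sE mulr_natl addrC cosD2pi sinD2pi cosN sinN.
by rewrite opprK.
Qed.

(* Main.v *)
(** Up to a positive factor, the phase shift at node j has cosine -a_j / b_j and
    sine -1 / b_j.  It is therefore in quadrant 2 iff a_j, b_j < 0 and can be in
    quadrant 3 only if a_j, b_j > 0.  All coefficients cannot be positive: going
    once around the ring with a left eigenvector for tau gives
    (tau - a_0) (tau - a_1) (tau - a_2) = b_0 b_1 b_2, whose two sides have
    opposite signs when tau <= 0. *)

Require Import Defs.
From mathcomp Require Import all_boot all_order all_algebra.
From mathcomp Require Import reals complex.
From mathcomp Require Import trigo ring lra.

Import Order.TTheory GRing.Theory Num.Theory.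

Local Open Scope ring_scope.
Local Open Scope complex_scope.

Lemma mod2pi_itv (R : realType) (x : R) : 0 <= mod2pi x < 2 * pi.
Proof.
have pi2_gt0 : 0 < 2 * pi :> R by rewrite mulr_gt0 ?pi_gt0.
have /andP[lo hi] := floor_itv (x / (2 * pi)).
rewrite /mod2pi subr_ge0 -ler_pdivlMr// lo /= ltrBlDl.
by rewrite -[X in _ < _ + X]mul1r -mulrDl -ltr_pdivrMr// -[1]/(1%:~R) -intrD.
Qed.

(** Signs of cosine and sine only see an angle modulo [2 * pi]; the range hypothesis is what lets
    them pin down the quadrant. *)
Lemma quadrant2E (R : realType) (x : R) : 0 <= x < 2 * pi ->
  quadrant2 x = (cos x < 0) && (0 < sin x).
Proof.
move=> /andP[x_ge0 x_lt]; have pi0 := pi_gt0 R; apply/idP/andP.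
  move=> /andP[lo hi]; split; last by rewrite sin_gt0_pi//; lra.
  by rewrite -oppr_gt0 -sinBpihalf sin_gt0_pi//; lra.
case=> c_lt0 s_gt0; apply/andP; split; rewrite ltNge.
  by apply: contraTN c_lt0 => ?; rewrite -leNgt cos_ge0_pihalf//; lra.
apply: contraTN s_gt0 => ?; rewrite -leNgt -[x](subrK pi) sinDpi oppr_le0.
by rewrite sin_ge0_pi//; lra.
Qed.

Lemma quadrant3_cos_sin (R : realType) (x : R) : quadrant3 x ->
  cos x < 0 /\ sin x < 0.
Proof.
have pi0 := pi_gt0 R; move=> /andP[lo hi].
rewrite -[x](subrK pi) cosDpi sinDpi !oppr_lt0; split.
  by rewrite cos_gt0_pihalf//; lra.
by rewrite sin_gt0_pi//; lra.
Qed.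

Section PhaseShift.
Variables (R : realType) (a b : 'I_3 -> R) (j : 'I_3).

Let z : R[i] := ('i%C - (a j)%:C) / (b j)%:C.

Let phase_cos_sin :
  cos (phase_shift a b j) = cos (arg z) /\
  sin (phase_shift a b j) = - sin (arg z).
Proof.
have [-> ->] := cos_sin_mod2pi (2 * pi - arg z).
by rewrite mulr_natl addrC cosD2pi sinD2pi cosN sinN.
Qed.

Let zE : z = (- (a j / b j)) +i* (b j)^-1.
Proof.
(* If [b j = 0], both sides are 0, since inversion sends 0 to 0. *)
have [b0|b0] := eqVneq (b j) 0.
  by rewrite /z b0 (rmorph0 (real_complex R)) !invr0 !mulr0 oppr0.
have bC0 : (b j)%:C != 0 :> R[i] by rewrite eq_complex /= eqxx andbT.
apply: (mulIf bC0); rewrite divfK//; apply/eqP; rewrite eq_complex /=.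
by rewrite !mulr0 !subr0 sub0r add0r mulNr divfK// mulVf// !eqxx.
Qed.

(** The common factor is the modulus of [z], so signs of cosine and sine can be read off the
    coordinates of [z]. *)
Let polar : b j != 0 -> exists2 r : R, 0 < r &
  - (a j / b j) = r * cos (arg z) /\ (b j)^-1 = r * sin (arg z).
Proof.
move=> b0; have z0 : z != 0 by rewrite zE eq_complex /= negb_and invr_eq0 b0 orbT.
exists (Normc.normc z).
  rewrite lt_neqAle eq_sym; apply/andP; split.
    by apply: contra z0 => /eqP/Normc.eq0_normc ->.
  by case: (z) => *; rewrite sqrtr_ge0.
have [_] := argP z0; rewrite [in LHS]zE => /eqP.
by rewrite eq_complex /= !mul0r subr0 addr0 => /andP[/eqP ? /eqP ?].
Qed.

Lemma cos_phase_shift_lt0 : (cos (phase_shift a b j) < 0) = (0 < a j / b j).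
Proof.
have [-> _] := phase_cos_sin.
have [b0|/polar[r r0 [cE _]]] := eqVneq (b j) 0.
  (* Here [z = 0], and the default value of [arg] at 0 is [acos 0 = pi / 2], with cosine 0: both
     sides are false. *)
  by rewrite zE /arg b0 invr0 !mulr0 oppr0 mul0r lexx acos0 cos_pihalf ltxx.
by rewrite -[RHS]oppr_lt0 cE pmulr_rlt0.
Qed.

Lemma sin_phase_shift_gt0 : b j != 0 ->
  (0 < sin (phase_shift a b j)) = (b j < 0).
Proof.
have [_ ->] := phase_cos_sin; case/polar=> r r0 [_ sE].
by rewrite oppr_gt0 -[RHS]invr_lt0 sE pmulr_rlt0.
Qed.

Lemma sin_phase_shift_lt0 : b j != 0 ->
  (sin (phase_shift a b j) < 0) = (0 < b j).
Proof.
have [_ ->] := phase_cos_sin; case/polar=> r r0 [_ sE].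
by rewrite oppr_lt0 -[RHS]invr_gt0 sE pmulr_rgt0.
Qed.

(** A negative cosine thus already forces [b j] to be nonzero, which spares deriving this from the
    spectrum. *)
Let divb_neq0 : 0 < a j / b j -> b j != 0.
Proof. by apply: contraTneq => ->; rewrite invr0 mulr0 ltxx. Qed.

Lemma quadrant2_phase_shift :
  quadrant2 (phase_shift a b j) = (a j < 0) && (b j < 0).
Proof.
rewrite quadrant2E ?mod2pi_itv// cos_phase_shift_lt0; apply/andP/andP.
  case=> ab; rewrite sin_phase_shift_gt0 ?divb_neq0// => b_lt0.
  by move: ab; rewrite nmulr_lgt0 ?invr_lt0.
case=> a_lt0 b_lt0; rewrite sin_phase_shift_gt0 ?lt_eqF//.
by rewrite nmulr_lgt0 ?invr_lt0.
Qed.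

Lemma quadrant3_phase_shift : quadrant3 (phase_shift a b j) ->
  0 < a j /\ 0 < b j.
Proof.
move=> /quadrant3_cos_sin[]; rewrite cos_phase_shift_lt0 => ab.
rewrite sin_phase_shift_lt0 ?divb_neq0// => b_gt0.
by move: ab; rewrite pmulr_lgt0 ?invr_gt0.
Qed.

End PhaseShift.

Lemma positive_ring_eigenvalue_gt0 (R : realType) (a b : 'I_3 -> R) (tau : R) :
  (forall j, 0 < a j) -> (forall j, 0 < b j) ->
  eigenvalue (ring_jacobian a b) tau -> 0 < tau.
Proof.
move=> a_gt0 b_gt0 /eigenvalueP[v vJ v_neq0]; rewrite ltNge.
apply: contra v_neq0 => tau_le0.
have step j : (tau - a (j + 1)) * v 0 (j + 1) = b j * v 0 j.
  have j1j : (j + 1 == j) = false by case: j => -[|[|[|]]].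
  (* Column [j + 1] of the Jacobian is supported on rows [j] and [j + 1]. *)
  move/matrixP: vJ => /(_ 0 (j + 1)); rewrite !mxE => vJj.
  rewrite mulrBl -vJj (bigD1 j)//= (bigD1 (j + 1)) ?j1j//= big1 => [|k].
    by rewrite !mxE !eqxx j1j; ring.
  case/andP=> kj kj1; rewrite !mxE (eq_sym _ k) (negPf kj1).
  by rewrite (inj_eq (addIr 1)) eq_sym (negPf kj) mulr0.
have j3 j : j + 1 + 1 + 1 = j :> 'I_3 by case: j => -[|[|[|]]]// ?; apply/val_inj.
(* Chaining [step] around the ring from any node [j] returns to [v 0 j]. The two products of
   coefficients have strictly opposite signs, so [v 0 j] vanishes. *)
apply/eqP/rowP=> j; rewrite mxE; apply/eqP.
have := step (j + 1 + 1); have := step (j + 1); have := step j; rewrite j3.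
set p0 := b j; set p1 := b _; set p2 := b _.
set q1 := tau - _; set q2 := tau - _; set q0 := tau - _ => s1 s2 s0.
have p_gt0 : 0 < p0 * p1 * p2 by rewrite !mulr_gt0 ?b_gt0.
have q_lt0 k : tau - a k < 0 by rewrite subr_lt0 (le_lt_trans tau_le0).
have q_neg : q0 * q1 * q2 < 0 by rewrite nmulr_llt0 ?nmulr_rgt0 ?q_lt0.
have : (p0 * p1 * p2 - q0 * q1 * q2) * v 0 j = 0.
  transitivity (p2 * (p1 * (p0 * v 0 j)) - q1 * q2 * (q0 * v 0 j)); first by ring.
  by rewrite s0 -s1 (mulrCA p1) -s2; ring.
by move/eqP; rewrite mulf_eq0 gt_eqF// subr_gt0 (lt_trans q_neg).
Qed.

Theorem theorem3p13 (R : realType) (a b : 'I_3 -> R) (tau : R)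
  (h_i : eigenvalue (jacobianC a b) 'i%C)
  (h_Ni : eigenvalue (jacobianC a b) (- 'i%C))
  (h_tau : eigenvalue (jacobianC a b) tau%:C)
  (tau_lt0 : tau < 0) :
  rotating_wave a b <-> (forall j, a j < 0) /\ (forall j, b j < 0).
Proof.
split=> [[q2|q3]|[a_lt0 b_lt0]].
- by split=> j; have := q2 j; rewrite quadrant2_phase_shift => /andP[].
- have ab j := quadrant3_phase_shift _ _ _ _ (q3 j).
  have := positive_ring_eigenvalue_gt0 _ a b tau
    (fun j => (ab j).1) (fun j => (ab j).2).
  (* The sign argument needs a real eigenvector, so the eigenvalue [tau] is brought down from the
     complexified matrix to the real one. *)
  move: h_tau; rewrite /jacobianC eigenvalue_map => h /(_ h).
  by rewrite ltNge ltW.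
- by left=> j; rewrite quadrant2_phase_shift a_lt0 b_lt0.
Qed.
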